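(* Let $\mathbb{F}$ be a commutative field, $r\ge 1$ an integer, and $d(X)=\sum_{\beta\in\mathbb{Z}^r}d_\beta X^\beta\in\mathbf{D}'$. The adjoint of the multiplication operator $$m_d:\mathbf{D}'\to\mathbf{D}',\quad c(X)\mapsto c(X)\cdot d(X),$$ is the shift operator $$\sigma_d:\mathbf{A}'\to\mathbf{A}',\quad W(Y)\mapsto d(X)\circ W(Y)=\sum_{\alpha\in\mathbb{Z}^r}\Big(\sum_{\beta\in\mathbb{Z}^r}d_\beta W_{\alpha+\beta}\Big)Y^\alpha,$$ where $W(Y)=\sum_{\alpha\in\mathbb{Z}^r}W_\alpha Y^\alpha$.
   Context: $\mathbf{D}'=\mathbb{F}[X_1,X_1^{-1},\dots,X_r,X_r^{-1}]$ is the ring of Laurent polynomials, with elements $d(X)=\sum_{\alpha\in\mathbb{Z}^r}d_\alpha X^\alpha$, where $d_\alpha\in\mathbb{F}$ and only finitely many $d_\alpha$ are nonzero; here $X^\alpha=X_1^{\alpha_1}\cdots X_r^{\alpha_r}$ for $\alpha=(\alpha_1,\dots,\alpha_r)\in\mathbb{Z}^r$. $\mathbf{A}'=\mathbb{F}[[Y_1,Y_1^{-1},\dots,Y_r,Y_r^{-1}]]$ is the $\mathbb{F}$-vector space of all formal two-sided (bi-infinite) Laurent series $W(Y)=\sum_{\alpha\in\mathbb{Z}^r}W_\alpha Y^\alpha$ with arbitrary coefficients $W_\alpha\in\mathbb{F}$ (no restriction on the support), where $Y^\alpha=Y_1^{\alpha_1}\cdots Y_r^{\alpha_r}$; addition and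 scalar multiplication are coefficientwise. The scalar product is the bilinear mapping $\langle\cdot,\cdot\rangle:\mathbf{D}'\times\mathbf{A}'\to\mathbb{F}$, $\langle d(X),W(Y)\rangle=\sum_{\alpha\in\mathbb{Z}^r}d_\alpha W_\alpha$. The map $\mathbf{A}'\to\operatorname{Hom}_{\mathbb{F}}(\mathbf{D}',\mathbb{F})$, $W(Y)\mapsto\langle\cdot,W(Y)\rangle$, is an isomorphism of $\mathbb{F}$-vector spaces, and is used to identify $\mathbf{A}'$ with $\operatorname{Hom}_{\mathbb{F}}(\mathbf{D}',\mathbb{F})$ (the space of all $\mathbb{F}$-linear maps $\mathbf{D}'\to\mathbb{F}$). The adjoint of an $\mathbb{F}$-linear map $m:\mathbf{D}'\to\mathbf{D}'$ is the map $\operatorname{Hom}_{\mathbb{F}}(m,\mathbb{F}):\operatorname{Hom}_{\mathbb{F}}(\mathbf{D}',\mathbb{F})\to\operatorname{Hom}_{\mathbb{F}}(\mathbf{D}',\mathbb{F})$, $\varphi\mapsto\varphi\circ m$ (composition of maps), regarded as a map $\mathbf{A}'\to\mathbf{A}'$ through the identification of $\mathbf{A}'$ with $\operatorname{Hom}_{\mathbb{F}}(\mathbf{D}',\mathbb{F})$ given by the isomorphism $W(Y)\mapsto\langle\cdot,W(Y)\rangle$. Equivalently, it is the unique map $\sigma:\mathbf{A}'\to\mathbf{A}'$ with $\langle m(c),W\rangle=\langle c,\sigma(W)\rangle$ for all $c\in\mathbf{D}'$ and $W\in\mathbf{A}'$. *)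

(* Defs.v *)
From HB Require Import structures.
From mathcomp Require Import all_boot all_order all_algebra finmap.
From mathcomp Require Import boolp functions.
From mathcomp.multinomials Require Export monalg.

Set Implicit Arguments.
Unset Strict Implicit.
Unset Printing Implicit Defensive.

Import GRing.Theory.

Local Open Scope fset_scope.
Local Open Scope ring_scope.

(* Z^r is 'rV[int]_r with its additive group structure. A Laurent polynomial
   c is its finitely supported family of coefficients: c@_a is the coefficient
   of X^a, msupp c the support, and << x *g a >> the term x X^a. *)
Definition laurent (F : fieldType) (r : nat) : Type := {malg F['rV[int]_r]}.

HB.instance Definition _ (F : fieldType) (r : nat) :=
  GRing.Lmodule.copy (laurent F r) {malg F['rV[int]_r]}.

Lemma malgZU (K : choiceType) (R : nzRingType) (x y : R) (k : K) :
  x *: << y *g k >> = << x * y *g k >> :> {malg R[K]}.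
Proof. by apply/malgP => l; rewrite mcoeffZ !mcoeffU mulrnAr. Qed.

(* monalg only provides a product when the exponents form a monoid without
   nontrivial units, which excludes Z^r; hence the ring structure below, in
   which X^a * X^b = X^(a + b). *)
Section LaurentRing.
Variables (F : fieldType) (r : nat).
Implicit Types (a b : 'rV[int]_r) (x y : F) (c d e : laurent F r).

Definition laurent_one : laurent F r := << 0 >>.

Definition laurent_mul c d : laurent F r :=
  \sum_(a <- msupp c) \sum_(b <- msupp d) << c@_a * d@_b *g a + b >>.

Lemma laurent_mulwE (A B : {fset 'rV[int]_r}) c d :
  msupp c `<=` A -> msupp d `<=` B ->
  laurent_mul c d = \sum_(a <- A) \sum_(b <- B) << c@_a * d@_b *g a + b >>.
Proof.
move=> leA leB; rewrite /laurent_mul (big_fset_incl _ leA) /=.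
  apply: eq_bigr => a _; apply: big_fset_incl => // b _ /mcoeff_outdom ->.
  by rewrite mulr0 monalgU0.
move=> a _ /mcoeff_outdom ca0.
by rewrite big1 // => b _; rewrite ca0 mul0r monalgU0.
Qed.

Lemma laurent_mulC : commutative laurent_mul.
Proof.
move=> c d; rewrite /laurent_mul exchange_big /=.
by apply: eq_bigr => b _; apply: eq_bigr => a _; rewrite mulrC addrC.
Qed.

Lemma laurent_mulDl : left_distributive laurent_mul +%R.
Proof.
move=> c d e; rewrite (laurent_mulwE (msuppD_le c d) (fsubset_refl _)).
rewrite (laurent_mulwE (fsubsetUl _ (msupp d)) (fsubset_refl (msupp e))).
rewrite (laurent_mulwE (fsubsetUr (msupp c) _) (fsubset_refl (msupp e))).
rewrite -big_split /=; apply: eq_bigr => a _.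
rewrite -big_split /=; apply: eq_bigr => b _.
by rewrite mcoeffD mulrDl monalgUD.
Qed.

Lemma laurent_mulDr : right_distributive laurent_mul +%R.
Proof. by move=> c d e; rewrite !(laurent_mulC c) laurent_mulDl. Qed.

Lemma laurent_mul0 : left_zero 0 laurent_mul.
Proof. by move=> c; rewrite /laurent_mul msupp0 big_seq_fset0. Qed.

Lemma laurent_mulUU x y a b :
  laurent_mul << x *g a >> << y *g b >> = << x * y *g a + b >>.
Proof.
rewrite (laurent_mulwE msuppU_le msuppU_le) !big_seq_fset1.
by rewrite !mcoeffUU.
Qed.

Lemma laurent_mul_suml (I : Type) (s : seq I) (f : I -> laurent F r) d :
  laurent_mul (\sum_(i <- s) f i) d = \sum_(i <- s) laurent_mul (f i) d.
Proof.
exact: (big_morph (laurent_mul^~ d) (fun _ _ => laurent_mulDl _ _ _)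
  (laurent_mul0 d)).
Qed.

Lemma laurent_mul_sumr (I : Type) (s : seq I) (f : I -> laurent F r) d :
  laurent_mul d (\sum_(i <- s) f i) = \sum_(i <- s) laurent_mul d (f i).
Proof.
rewrite laurent_mulC laurent_mul_suml.
by apply: eq_bigr => i _; rewrite laurent_mulC.
Qed.

Lemma laurent_mulA : associative laurent_mul.
Proof.
have mulUA x y z a b k :
    laurent_mul << x *g a >> (laurent_mul << y *g b >> << z *g k >>) =
    laurent_mul (laurent_mul << x *g a >> << y *g b >>) << z *g k >>.
  rewrite [X in laurent_mul _ X = _]laurent_mulUU [LHS]laurent_mulUU.
  rewrite [X in _ = laurent_mul X _]laurent_mulUU [RHS]laurent_mulUU.
  by rewrite (mulrA x) (addrA a).
have mul_sumA (s t u : seq 'rV[int]_r) (f g h : 'rV[int]_r -> laurent F r) :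
    (forall i j k, laurent_mul (f i) (laurent_mul (g j) (h k)) =
                   laurent_mul (laurent_mul (f i) (g j)) (h k)) ->
    laurent_mul (\sum_(i <- s) f i)
      (laurent_mul (\sum_(j <- t) g j) (\sum_(k <- u) h k)) =
    laurent_mul (laurent_mul (\sum_(i <- s) f i) (\sum_(j <- t) g j))
      (\sum_(k <- u) h k).
  move=> fghA; rewrite !(laurent_mul_suml s); apply: eq_bigr => i _.
  rewrite (laurent_mul_suml t) !(laurent_mul_sumr t) (laurent_mul_suml t).
  apply: eq_bigr => j _.
  by rewrite !(laurent_mul_sumr u); apply: eq_bigr => k _.
move=> c d e; rewrite (monalgE c) (monalgE d) (monalgE e).
by apply: mul_sumA => i j k; exact: mulUA.
Qed.

Lemma laurent_mul1 : left_id laurent_one laurent_mul.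
Proof.
move=> c; rewrite (monalgE c) (laurent_mul_sumr (msupp c)); apply: eq_bigr => i _.
by rewrite laurent_mulUU mul1r add0r.
Qed.

Lemma laurent_one_neq0 : laurent_one != 0.
Proof. by rewrite monalgU_eq0 oner_eq0. Qed.

HB.instance Definition _ := GRing.Zmodule_isComNzRing.Build (laurent F r)
  laurent_mulA laurent_mulC laurent_mul1 laurent_mulDl laurent_one_neq0.

Lemma laurent_scaleAl x c d : x *: (c * d) = (x *: c) * d.
Proof.
rewrite /GRing.mul /= (laurent_mulwE (msuppZ_le x c) (fsubset_refl (msupp d))).
rewrite /laurent_mul scaler_sumr; apply: eq_bigr => a _.
rewrite scaler_sumr; apply: eq_bigr => b _.
by rewrite mcoeffZ malgZU mulrA.
Qed.

HB.instance Definition _ :=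
  GRing.Lmodule_isLalgebra.Build F (laurent F r) laurent_scaleAl.
HB.instance Definition _ :=
  GRing.Lalgebra_isComAlgebra.Build F (laurent F r).

End LaurentRing.

(* W a is the coefficient of Y^a. *)
Definition biseries (F : fieldType) (r : nat) : Type := 'rV[int]_r -> F.

HB.instance Definition _ (F : fieldType) (r : nat) :=
  GRing.Lmodule.copy (biseries F r) ('rV[int]_r -> F^o).

Section Duality.
Variables (F : fieldType) (r : nat).
Implicit Types (a b : 'rV[int]_r) (x : F) (c d : laurent F r).
Implicit Types (V W : biseries F r) (phi : {scalar laurent F r}).

Definition pairing c W : F := \sum_(a <- msupp c) c@_a * W a.

Lemma pairingwE (A : {fset 'rV[int]_r}) c W :
  msupp c `<=` A -> pairing c W = \sum_(a <- A) c@_a * W a.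
Proof.
by move=> leA; apply: big_fset_incl => // a _ /mcoeff_outdom ->; rewrite mul0r.
Qed.

Lemma pairingU x a W : pairing << x *g a >> W = x * W a.
Proof. by rewrite (pairingwE _ msuppU_le) big_seq_fset1 mcoeffUU. Qed.

Lemma pairing_linearl W : scalar (pairing^~ W).
Proof.
move=> x c d; have le1 : msupp (x *: c + d) `<=` msupp c `|` msupp d.
  exact: fsubset_trans (msuppD_le _ _) (fsetSU _ (msuppZ_le _ _)).
rewrite (pairingwE _ le1) (pairingwE W (fsubsetUl _ (msupp d))).
rewrite (pairingwE W (fsubsetUr (msupp c) _)) mulr_sumr -big_split /=.
by apply: eq_bigr => a _; rewrite mcoeffD mcoeffZ mulrDl mulrA.
Qed.

Lemma pairing_linearr c : scalar (pairing c).
Proof.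
move=> x V W; rewrite /pairing mulr_sumr -big_split /=.
by apply: eq_bigr => a _; rewrite mulrDr mulrCA.
Qed.

Lemma laurent_scaleU x y a :
  x *: (<< y *g a >> : laurent F r) = << x * y *g a >>.
Proof. exact: malgZU. Qed.

Definition dual_fun W : laurent F r -> F := pairing^~ W.

HB.instance Definition _ W :=
  GRing.isLinear.Build F (laurent F r) F *%R (dual_fun W) (pairing_linearl W).

(* to_dual is the identification of the biseries with the dual of the Laurent
   polynomials: it is linear by pairing_linearr and bijective by to_dualK and
   of_dualK. *)
Definition to_dual W : {scalar laurent F r} := dual_fun W.

Definition of_dual phi : biseries F r := fun a => phi << a >>.

Lemma to_dualK : cancel to_dual of_dual.
Proof.
by move=> W; apply/funext => a; rewrite /of_dual /= /dual_fun pairingU mul1r.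
Qed.

Lemma scalar_form_eq (phi psi : {scalar laurent F r}) : phi =1 psi -> phi = psi.
Proof.
case: phi psi => [f cf] [g cg] /= /funext efg.
case: g / efg cg => -[[a'] [b']]; case: cf => -[a] [b].
by rewrite (Prop_irrelevance a' a) (Prop_irrelevance b' b).
Qed.

Lemma of_dualK : cancel of_dual to_dual.
Proof.
move=> phi; apply: scalar_form_eq => c /=.
rewrite [in RHS](monalgE c) /dual_fun /pairing linear_sum /=.
apply: eq_bigr => a _; rewrite /of_dual -linearZ.
by rewrite laurent_scaleU mulr1.
Qed.

(* Hom(m, F). *)
Definition dual_map (m : {linear laurent F r -> laurent F r}) phi :
  {scalar laurent F r} := phi \o m.

Definition adjoint (m : {linear laurent F r -> laurent F r}) :
  biseries F r -> biseries F r := of_dual \o dual_map m \o to_dual.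

Lemma adjointP (m : {linear laurent F r -> laurent F r}) c W :
  pairing (m c) W = pairing c (adjoint m W).
Proof.
by have /(congr1 (fun phi : {scalar _} => phi c)) :=
  of_dualK (dual_map m (to_dual W)).
Qed.

Definition mul_op d : laurent F r -> laurent F r := fun c => c * d.

Lemma mul_op_linear d : linear (mul_op d).
Proof. by move=> x c e; rewrite /mul_op mulrDl scalerAl. Qed.

HB.instance Definition _ d :=
  GRing.isLinear.Build F (laurent F r) (laurent F r) *:%R (mul_op d)
    (mul_op_linear d).

Definition shift_op d : biseries F r -> biseries F r :=
  fun W a => \sum_(b <- msupp d) d@_b * W (a + b).

End Duality.

(* Main.v *)
Require Import Defs.
From mathcomp Require Import all_boot all_order all_algebra.
From mathcomp Require Import finmap boolp.

Import GRing.Theory.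
Local Open Scope ring_scope.

(** Under the identification of series with functionals, the coefficient at [a] is the value on the
    monomial [X^a]. For the adjoint this is the pairing of [X^a d] with [W], and [mul_opU] expands
    [X^a d] into monomials. *)

Lemma mul_opU (F : fieldType) (r : nat) (d : laurent F r) (a : 'rV[int]_r) :
  mul_op d << a >> = \sum_(b <- msupp d) (<< d@_b *g a + b >> : laurent F r).
Proof.
rewrite /mul_op [in LHS](monalgE d) [LHS](laurent_mul_sumr (msupp d)).
by apply: eq_bigr => b _; rewrite laurent_mulUU mul1r.
Qed.

Theorem theorem3p6 (F : fieldType) (r : nat) (hr : (1 <= r)%N)
    (d : laurent F r) :
  adjoint (mul_op d) = shift_op d.
Proof.
apply/funext => W; apply/funext => a.
(* Linearity of the functional [dual_fun W] reduces the claim to single terms, each contributing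
   [d@_b * W (a + b)]. *)
rewrite /adjoint /of_dual /= mul_opU linear_sum.
by apply: eq_bigr => b _; exact: pairingU.
Qed.
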